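(* (Non-commutative duality principle) For any quasi-poset $P\in\mathbf{QP}$: $$EHR(P)=(-1)^{cl(P)}\,\Phi_{-1}\circ EHR^{str}(P),\qquad EHR^{str}(P)=(-1)^{cl(P)}\,\Phi_{-1}\circ EHR(P).$$
   Context: $\mathbb{K}$ is a field of characteristic zero, $[n]=\{1,\ldots,n\}$. $\mathbf{QP}$ is the set of quasi-posets $P=([n],\leq_P)$, $n\geq0$ ($\leq_P$ reflexive and transitive); $i\sim_Pj$ means $i\leq_Pj$ and $j\leq_Pi$; $cl(P)$ is the number of $\sim_P$-classes. $\mathcal{H}_{\mathbf{QP}}$ is the $\mathbb{K}$-vector space with basis $\mathbf{QP}$. A packed word of length $n$ is a word $w=w_1\ldots w_n$ in positive integers with $\{w_1,\ldots,w_n\}=[k]$ for some $k\ge0$ (then $k=\max(w)$); it is identified with the surjection $[n]\to[k]$, $i\mapsto w(i)=w_i$. $\mathbf{WQSym}$ is the $\mathbb{K}$-vector space with basis the set of packed words. For $P\in\mathbf{QP}$ on $[n]$, $W_P$ is the set of packed words $w$ of length $n$ such that $i\leq_Pj\Rightarrow w(i)\leq w(j)$; $W^{str}_P$ is the set of $w\in W_P$ such that ($i\leq_Pj$ and $w(i)=w(j)$) implies $i\sim_Pj$ (for the empty quasi-poset both consist of the empty word). $EHR,EHR^{str}:\mathcal{H}_{\mathbf{QP}}\to\mathbf{WQSym}$ are the linear maps with $EHR(P)=\sum_{w\in W_P}w$, $EHR^{str}(P)=\sum_{w\in W_P^{str}}w$. $\Phi_{-1}:\mathbf{WQSym}\to\mathbf{WQSym}$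 is the linear map defined by $\Phi_{-1}(w)=(-1)^{\max(w)}\sum_{\sigma}\sigma\circ w$, where the sum is over all $l$ and all non-decreasing surjections $\sigma:[\max(w)]\to[l]$. *)

(* Defs.v *)
From HB Require Import structures.
From mathcomp Require Import all_boot all_order all_algebra.
From mathcomp.multinomials Require Export freeg.

Set Implicit Arguments.
Unset Strict Implicit.
Unset Printing Implicit Defensive.

Import GRing.Theory.
Local Open Scope ring_scope.

(* The index set [n] = {1, ..., n} carrying a quasi-poset is rendered as
   'I_n = {0, ..., n-1}: index i : 'I_n stands for i + 1. *)
Record qposet (n : nat) := QPoset {
  qrel : {ffun 'I_n * 'I_n -> bool};
  qrelP : [forall i, qrel (i, i)] &&
          [forall i, forall j, forall k,
            qrel (i, j) && qrel (j, k) ==> qrel (i, k)] }.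

HB.instance Definition _ n := [isSub for @qrel n].
HB.instance Definition _ n := [Finite of qposet n by <:].

Definition QP : choiceType := {n : nat & qposet n}.

Definition qle (P : QP) (i j : 'I_(tag P)) : bool := qrel (tagged P) (i, j).

Definition qsim (P : QP) (i j : 'I_(tag P)) : bool := qle i j && qle j i.

Lemma qle_refl (P : QP) : reflexive (@qle P).
Proof. by move=> i; have /andP[/forallP qP _] := qrelP (tagged P); exact: qP. Qed.

Lemma qle_trans (P : QP) : transitive (@qle P).
Proof.
move=> j i k ij jk; have /andP[_ /forallP/(_ i)/forallP/(_ j)/forallP/(_ k)] :=
  qrelP (tagged P).
by move/implyP; apply; apply/andP.
Qed.

Definition cl (P : QP) : nat :=
  #|equivalence_partition (@qsim P) [set: 'I_(tag P)]|.

Definition wmax (w : seq nat) : nat := \max_(a <- w) a.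

Definition packed (w : seq nat) : bool :=
  all (fun a => 0 < a)%N w && all (mem w) (iota 1 (wmax w)).

Lemma leq_wmax (w : seq nat) a : a \in w -> (a <= wmax w)%N.
Proof. by move=> aw; rewrite /wmax (big_rem a) //= leq_maxl. Qed.

Lemma wmax_eq (w : seq nat) k : w =i iota 1 k -> wmax w = k.
Proof.
move=> wk; apply/eqP; rewrite eqn_leq; apply/andP; split.
  by apply/bigmax_leqP_seq => a; rewrite wk mem_iota add1n ltnS => /andP[].
by case: k wk => // k wk; apply: leq_wmax; rewrite wk mem_iota add1n ltnS leqnn.
Qed.

Lemma packedP (w : seq nat) : reflect (exists k, w =i iota 1 k) (packed w).
Proof.
apply: (iffP andP) => [[/allP w0 /allP wm]|[k wk]].
  exists (wmax w) => a; apply/idP/idP => [aw|/wm //].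
  by rewrite mem_iota add1n ltnS leq_wmax // w0.
split; apply/allP => a.
  by rewrite wk mem_iota => /andP[].
by rewrite (wmax_eq wk) -wk.
Qed.

Record pword := PWord { letters :> seq nat; lettersP : packed letters }.

HB.instance Definition _ := [isSub for letters].
HB.instance Definition _ := [Countable of pword by <:].

(* w(i), which for i : 'I_n is the (i + 1)-st letter of w *)
Definition letter (w : pword) (i : nat) : nat := nth 0%N w i.

(* All packed words of length n, each listed once; letters of such a word
   are at most n, so tuples over 'I_n.+1 are enough. *)
Definition pwords (n : nat) : seq pword :=
  pmap insub [seq map val (t : n.-tuple 'I_n.+1) | t : n.-tuple 'I_n.+1].

Lemma pwords_uniq n : uniq (pwords n).
Proof.
apply: (pmap_uniq (insubK _)); rewrite map_inj_uniq ?enum_uniq //.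
by move=> s t /(inj_map val_inj)/val_inj.
Qed.

Lemma wmax_leq_size (w : pword) : (wmax w <= size w)%N.
Proof.
rewrite -{1}(size_iota 1 (wmax w)) uniq_leq_size ?iota_uniq // => a.
by have /andP[_ /allP] := lettersP w; apply.
Qed.

Lemma mem_pwords n (w : pword) : (w \in pwords n) = (size w == n).
Proof.
rewrite (mem_pmap_sub (sT := pword)); apply/mapP/eqP => [[t _ ->]|wn].
  by rewrite size_map size_tuple.
have sz : size [seq inord a : 'I_n.+1 | a <- w] == n by rewrite size_map wn.
exists (Tuple sz); first by rewrite mem_enum.
rewrite /= -map_comp -[LHS]map_id; apply/eq_in_map => a aw /=.
by rewrite inordK // ltnS (leq_trans (leq_wmax aw)) // -wn wmax_leq_size.
Qed.

Lemma packed_nil : packed [::].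
Proof. by rewrite /packed /wmax big_nil. Qed.

(* The composition s o w of surjections w : [n] -> [k] and s : [k] -> [l], that
   is, the word s(w_1) ... s(w_n).  The default value [::] is only reached
   outside of the composable case; see wcompE. *)
Definition wcomp (s w : pword) : pword :=
  insubd (PWord packed_nil) [seq letter s a.-1 | a <- w].

Lemma wcompE (s w : pword) : size s = wmax w ->
  wcomp s w = [seq letter s a.-1 | a <- w] :> seq nat.
Proof.
move=> sw; rewrite /wcomp insubdK //; apply/packedP.
have /packedP[l sl] := lettersP s; exists l => b; rewrite -sl.
have /andP[/allP w0 /allP wm] := lettersP w.
apply/mapP/idP => [[a aw ->]|bs].
  by rewrite /letter mem_nth // sw prednK ?leq_wmax // w0.
exists (index b s).+1; last by rewrite /letter /= nth_index.
by apply: wm; rewrite mem_iota /= add1n ltnS -sw index_mem.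
Qed.

Definition W (P : QP) : {pred pword} := fun w =>
  (size w == tag P) &&
  [forall i : 'I_(tag P), forall j : 'I_(tag P),
    qle i j ==> (letter w i <= letter w j)%N].

Definition Wstr (P : QP) : {pred pword} := fun w =>
  (w \in W P) &&
  [forall i : 'I_(tag P), forall j : 'I_(tag P),
    qle i j && (letter w i == letter w j) ==> qsim i j].

Section LinearMaps.
Variable K : fieldType.

Definition HQP := {freeg QP / K}.
Definition WQSym := {freeg pword / K}.

(* fglift f is the linear extension of a map f defined on the basis: it is
   linear, and fglift f << x >> = f x. *)
Lemma fglift_linear (T : choiceType) (V : lmodType K) (f : T -> V) :
  linear (fglift f : {freeg T / K} -> V).
Proof.
have liftD (x y : {freeg T / K}) : fglift f (x + y) = fglift f x + fglift f y.
  have lB := lift_is_additive f; have lN z : fglift f (- z) = - fglift f z.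
    by rewrite -[in LHS](sub0r z) lB -(subrr z) lB subrr sub0r.
  by rewrite -[y in LHS]opprK lB lN opprK.
move=> a x y; rewrite liftD; congr (_ + _).
have -> : a *: x = [freeg [seq (a * coeff z x, z) | z <- dom x]].
  apply/eqP/freeg_eqP => z; rewrite coeffZ -{1}(Freeg_dom x) !coeff_Freeg.
  by rewrite /precoeff !big_map big_distrr.
rewrite -[in RHS](Freeg_dom x) !fglift_Freeg /prelift !big_map scaler_sumr.
by apply: eq_bigr => z _; rewrite scalerA.
Qed.

Lemma fglift_basis (T : choiceType) (V : lmodType K) (f : T -> V) (x : T) :
  fglift f (<< x >> : {freeg T / K}) = f x.
Proof. by rewrite liftU scale1r. Qed.

Definition EHR : HQP -> WQSym :=
  fglift (fun P : QP => \sum_(w <- pwords (tag P) | w \in W P) (<< w >> : WQSym)).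

Definition EHRstr : HQP -> WQSym :=
  fglift (fun P : QP => \sum_(w <- pwords (tag P) | w \in Wstr P) (<< w >> : WQSym)).

(* The non-decreasing surjections [k] -> [l], for all l, are exactly the
   packed words of length k that are sorted. *)
Definition Phi_m1 : WQSym -> WQSym :=
  fglift (fun w : pword => (-1) ^+ wmax w *:
    \sum_(s <- pwords (wmax w) | sorted leq s) (<< wcomp s w >> : WQSym)).

End LinearMaps.

(* Main.v *)
Require Import Defs.
From HB Require Import structures.
From mathcomp Require Import all_boot all_order all_algebra.
From mathcomp Require Import zify.

(** Packed words of length [n] are total preorders on the indices, compared by
    their letters.  Composing [w] with a non-decreasing surjection merges
    consecutive blocks of [w], so up to a sign [Phi_m1 << w >>] is the sum of
    all words [u] coarser than [w] ([sum_sorted_wcomp]).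

    The first identity compares coefficients of [u].  The words of [Wstr P]
    that are finer than [u] must be counted with sign (-1)^max.  There is none
    unless [u] is in [W P], and if it is, they are the strict words of one
    other preorder: compare indices by their letters in [u], and by [P] within a
    block of [u].  This preorder has the same classes as [P], so everything
    reduces to the signed count [sum_strict]: over the strict words of any
    preorder, the signs (-1)^max add up to (-1)^(number of classes).

    The signed count is an induction on the number of incomparable pairs.  If
    [x] and [y] are incomparable, a strict word puts [x] before [y], after
    [y], or in the same block.  These three families are the strict words of the
    preorders obtained by adding x < y, by adding y < x and by identifying [x]
    with [y].  With c classes the first two contribute (-1)^c each and the third
    (-1)^(c-1), in total (-1)^c.  When nothing is incomparable, there is
    exactly one strict word, and its blocks are the classes.

    The second identity follows from the first because [Phi_m1] is an
    involution ([Phi_m1_involutive]).  The coefficient of [u] in the square at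
    [w] is, up to sign, the sum of (-1)^max over the words between [w] and [u]; if
    [w] and [u] differ, some pair of consecutive blocks of [w] lies in one block
    of [u], and merging or separating these two blocks pairs off the words
    between with opposite signs ([sum_between]). *)

Set Implicit Arguments.
Unset Strict Implicit.
Unset Printing Implicit Defensive.

Import GRing.Theory.
Local Open Scope ring_scope.

(** * Letters of a packed word *)

Lemma letter_gt0 n (w : pword) (i : 'I_n) : w \in pwords n -> (0 < letter w i)%N.
Proof.
rewrite mem_pwords => /eqP wn; have /andP[/allP w0 _] := lettersP w.
by apply: w0; rewrite mem_nth // wn.
Qed.

Lemma letter_leq_wmax n (w : pword) (i : 'I_n) :
  w \in pwords n -> (letter w i <= wmax w)%N.
Proof. by rewrite mem_pwords => /eqP wn; rewrite leq_wmax // mem_nth // wn. Qed.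

Lemma letter_onto n (w : pword) a : w \in pwords n -> (0 < a <= wmax w)%N ->
  exists i : 'I_n, letter w i = a.
Proof.
rewrite mem_pwords => /eqP wn /andP[a0 aw].
have /andP[_ /allP/(_ a)] := lettersP w.
rewrite mem_iota a0 add1n ltnS aw => /(_ isT) /(nthP 0%N)[i + <-].
by rewrite wn => lt_in; exists (Ordinal lt_in).
Qed.

Lemma letters_inj n (w u : pword) : w \in pwords n -> u \in pwords n ->
  (forall i : 'I_n, letter w i = letter u i) -> w = u.
Proof.
rewrite !mem_pwords => /eqP wn /eqP un wu; apply: val_inj.
apply: (@eq_from_nth _ 0%N) => [|i]; first by rewrite wn un.
by rewrite /= wn => lt_in; exact: (wu (Ordinal lt_in)).
Qed.

(** Meant for functions onto an interval 1, ..., k; every other [f] gives the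
    empty word. *)
Definition word_of n (f : 'I_n -> nat) : pword :=
  insubd (PWord packed_nil) [seq f i | i <- enum 'I_n].

Lemma word_ofP n (f : 'I_n -> nat) k :
  (forall i, 0 < f i <= k)%N ->
  (forall a, (0 < a <= k)%N -> exists i, f i = a) ->
  [/\ word_of f \in pwords n, wmax (word_of f) = k &
      forall i : 'I_n, letter (word_of f) i = f i].
Proof.
move=> f_bound f_onto; pose l := [seq f i | i <- enum 'I_n].
have lk : l =i iota 1 k.
  move=> a; rewrite mem_iota add1n ltnS; apply/mapP/idP => [[i _ ->]//|].
  by case/f_onto => i <-; exists i; rewrite ?mem_enum.
have wE : word_of f = l :> seq nat.
  by rewrite insubdK //; apply/packedP; exists k.
split=> [||i]; first by rewrite mem_pwords wE size_map size_enum_ord.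
  by rewrite wE (wmax_eq lk).
by rewrite /letter wE (nth_map i) ?size_enum_ord // nth_ord_enum.
Qed.

Lemma card_imset_kernel (I T1 T2 : finType) (f : I -> T1) (g : I -> T2) :
  (forall i j, (f i == f j) = (g i == g j)) ->
  #|f @: [set: I]| = #|g @: [set: I]|.
Proof.
move=> fg; pose p i := (f i, g i).
have -> : f @: [set: I] = fst @: (p @: [set: I]) by rewrite -imset_comp.
have -> : g @: [set: I] = snd @: (p @: [set: I]) by rewrite -imset_comp.
rewrite (@card_in_imset _ _ fst) ?(@card_in_imset _ _ snd) //.
  move=> a b /imsetP[i _ ->] /imsetP[j _ ->] /= E.
  by rewrite /p E; congr (_, _); apply/eqP; rewrite fg E.
move=> a b /imsetP[i _ ->] /imsetP[j _ ->] /= E.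
by rewrite /p E; congr (_, _); apply/eqP; rewrite -fg E.
Qed.

(** The letters of [w] are exactly 1, ..., [wmax w], so [wmax w] is the number
    of blocks of [w], which depends on the partition into blocks alone. *)
Lemma wmax_card n (w : pword) (T : finType) (f : 'I_n -> T) :
  w \in pwords n -> (forall i j : 'I_n, (f i == f j) = (letter w i == letter w j)) ->
  wmax w = #|f @: [set: 'I_n]|.
Proof.
move=> wn fw; pose g (i : 'I_n) : 'I_(wmax w).+1 := inord (letter w i).
have gE i : g i = letter w i :> nat by rewrite inordK // ltnS letter_leq_wmax.
rewrite (@card_imset_kernel _ _ _ f g) => [|i j]; last first.
  by rewrite fw -(inj_eq val_inj (g i)) /= !gE.
suff -> : g @: [set: 'I_n] = [set~ ord0] by rewrite cardsC1 card_ord.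
apply/setP => a; rewrite !inE; apply/imsetP/idP => [[i _ ->]|a0].
  by rewrite -(inj_eq val_inj) /= gE -lt0n letter_gt0.
have [|i wi] := @letter_onto n w a wn; last first.
  by exists i => //; apply/val_inj; rewrite /= gE.
by rewrite lt0n a0 -ltnS ltn_ord.
Qed.

(** Replacing each value of [h] by its position among the sorted values gives
    a packed word. *)
Lemma pack_exists n (h : 'I_n -> nat) : exists2 w, w \in pwords n &
  forall i j : 'I_n, (letter w i <= letter w j)%N = (h i <= h j)%N.
Proof.
pose hs := [seq h i | i <- enum 'I_n]; pose t := sort leq (undup hs).
have tE a : (a \in t) = (a \in hs) by rewrite mem_sort mem_undup.
have ut : uniq t by rewrite sort_uniq undup_uniq.
have ht k : h k \in t by rewrite tE map_f ?mem_enum.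
have index_leq :=
  sorted_leq_index leq_trans leqnn (sort_sorted leq_total _ : sorted leq t).
have [i|a /andP[a0 a_le]|wn _ wE] :=
  @word_ofP n (fun i => (index (h i) t).+1) (size t); first by rewrite index_mem ht.
  have : nth 0%N t a.-1 \in hs by rewrite -tE mem_nth ?prednK.
  by case/mapP => i _ hi; exists i; rewrite -hi index_uniq ?prednK.
exists (word_of (fun i => (index (h i) t).+1)) => // i j; rewrite !wE ltnS.
apply/idP/idP => [|ij]; first exact: index_leq.
rewrite leqNgt; apply/negP => lt_ji.
have ji : (h j <= h i)%N by apply: index_leq (ht j) (ht i) (ltnW lt_ji).
have eq_ij : h i = h j by apply/eqP; rewrite eqn_leq ij.
by rewrite eq_ij ltnn in lt_ji.
Qed.

(** * The coarsening order *)

Definition coarser n (w u : pword) : bool :=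
  [forall i : 'I_n, forall j : 'I_n,
    (letter w i <= letter w j)%N ==> (letter u i <= letter u j)%N].

Lemma coarserP n (w u : pword) :
  reflect (forall i j : 'I_n, (letter w i <= letter w j)%N ->
             (letter u i <= letter u j)%N) (coarser n w u).
Proof.
apply: (iffP forallP) => [wu i j|wu i]; first exact/implyP/(forallP (wu i)).
by apply/forallP => j; apply/implyP/wu.
Qed.

Lemma coarser_le n (w u : pword) : coarser n w u ->
  forall i j : 'I_n, (letter w i <= letter w j)%N -> (letter u i <= letter u j)%N.
Proof. exact/coarserP. Qed.

Lemma coarser_refl n w : coarser n w w.
Proof. exact/coarserP. Qed.

(** Merging blocks can only lower letters.  Formally, by induction on the letter
    of [w] at [i]: if the letter of [u] at [i] were larger, then an index [j]
    where [u] is one less would have a smaller letter in [w], contradicting the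
    induction hypothesis at [j]. *)
Lemma coarser_letter n (w u : pword) (i : 'I_n) :
  w \in pwords n -> u \in pwords n -> coarser n w u ->
  (letter u i <= letter w i)%N.
Proof.
move=> wn un /coarserP wu; elim/ltn_ind: {i}(letter w i) {-2}i (erefl (letter w i)).
move=> a IH i wi; rewrite leqNgt; apply/negP => a_lt.
have a0 : (0 < a)%N by rewrite -wi letter_gt0.
have [|j uj] := @letter_onto n u (letter u i).-1 un.
  by have := letter_leq_wmax i un; lia.
have ji : (letter w j < a)%N.
  by rewrite -wi ltnNge; apply/negP => /wu; lia.
by have := IH _ ji j erefl; lia.
Qed.

Lemma coarser_anti n (w u : pword) : w \in pwords n -> u \in pwords n ->
  coarser n w u -> coarser n u w -> w = u.
Proof.
move=> wn un wu uw; apply: (letters_inj wn un) => i.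
by apply/eqP; rewrite eqn_leq !coarser_letter.
Qed.

(** * Signed counting of strict words *)

Definition strict n (r : rel 'I_n) (w : pword) : bool :=
  [forall i : 'I_n, forall j : 'I_n, r i j ==>
    (letter w i <= letter w j)%N && ((letter w i == letter w j) ==> r j i)].

Lemma strictP n (r : rel 'I_n) (w : pword) :
  reflect (forall i j, r i j -> (letter w i <= letter w j)%N /\
             (letter w i = letter w j -> r j i)) (strict r w).
Proof.
apply: (iffP forallP) => [rw i j rij|rw i].
  have /forallP/(_ j)/implyP/(_ rij)/andP[-> /implyP eqw] := rw i.
  by split=> // /eqP.
apply/forallP => j; apply/implyP => /rw[-> eqw] /=.
by apply/implyP => /eqP.
Qed.

(** The word of a total preorder is found by packing the sizes of the
    down-sets. *)
Lemma sum_strict_total (R : pzRingType) n (r : rel 'I_n) (T : finType)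
    (f : 'I_n -> T) :
  reflexive r -> transitive r -> total r ->
  (forall i j, (f i == f j) = r i j && r j i) ->
  \sum_(w <- pwords n | strict r w) (-1) ^+ wmax w
    = (-1) ^+ #|f @: [set: 'I_n]| :> R.
Proof.
move=> r_refl r_trans r_total fr.
pose h i := #|[set j | r j i]|.
have hE i j : (h i <= h j)%N = r i j.
  case: (boolP (r i j)) => rij.
    by apply/subset_leq_card/subsetP => k; rewrite !inE => /r_trans; apply.
  have rji : r j i by have := r_total i j; rewrite (negbTE rij).
  apply/negbTE; rewrite -ltnNge; apply/proper_card/properP; split.
    by apply/subsetP => k; rewrite !inE => /r_trans; apply.
  by exists i; rewrite !inE.
have [w wn wE] := pack_exists h.
have -> : #|f @: [set: 'I_n]| = wmax w.
  by rewrite (@wmax_card _ _ _ f) // => i j; rewrite fr eqn_leq !wE !hE.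
rewrite big_seq_cond (eq_bigl (pred1 w)); last first.
  move=> v /=; apply/andP/eqP => [[vn /strictP rv]|->]; last first.
    split=> //; apply/strictP => i j; rewrite -hE -wE => wij; split=> //.
    by rewrite -hE -wE => ->.
  have vr (i j : 'I_n) : (letter v i <= letter v j)%N = r i j.
    apply/idP/idP => [vij|/rv[]//]; case/orP: (r_total i j) => // /rv[vji].
    by apply; apply/eqP; rewrite eqn_leq vij vji.
  by apply: (@coarser_anti n) => //; apply/coarserP => i j; rewrite vr wE hE.
by rewrite -big_filter filter_pred1_uniq ?pwords_uniq // big_seq1.
Qed.

Definition add_below (T : Type) (r : rel T) (a b : T) : rel T :=
  fun i j => r i j || r i a && r b j.

Definition identify (T : Type) (r : rel T) (x y : T) : rel T :=
  fun i j => [|| r i j, r i x && r y j | r i y && r x j].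

Lemma no_path (T : Type) (r : rel T) (x y : T) :
  transitive r -> ~~ r y x -> forall i j, r y i -> r i j -> r j x -> False.
Proof.
move=> r_trans nyx i j yi ij jx; case/negP: nyx.
exact: r_trans yi (r_trans _ _ _ ij jx).
Qed.

Lemma add_below_trans (T : Type) (r : rel T) (a b : T) :
  transitive r -> ~~ r b a -> transitive (add_below r a b).
Proof.
move=> r_trans nba j i k; rewrite /add_below.
case/orP => [ij|/andP[ia bj]] /orP[jk|/andP[ja bk]].
- by rewrite (r_trans _ _ _ ij jk).
- by rewrite (r_trans _ _ _ ij ja) bk orbT.
- by rewrite ia (r_trans _ _ _ bj jk) orbT.
- by case/negP: nba; apply: r_trans bj ja.
Qed.

Lemma add_below_sim (T : Type) (r : rel T) (a b : T) :
  transitive r -> ~~ r b a ->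
  forall i j, add_below r a b i j && add_below r a b j i = r i j && r j i.
Proof.
move=> r_trans nba i j; apply/andP/andP; rewrite /add_below.
  case=> /orP[ij|/andP[ia bj]] /orP[ji|/andP[ja bi]] //.
  - by case: (no_path r_trans nba bi ij ja).
  - by case: (no_path r_trans nba bj ji ia).
  - by case/negP: nba; apply: r_trans bj ja.
by case=> -> ->.
Qed.

Lemma identify_trans (T : Type) (r : rel T) (x y : T) :
  transitive r -> transitive (identify r x y).
Proof.
move=> r_trans j i k; rewrite /identify => /or3P[ij|/andP[ia bj]|/andP[ia bj]]
  /or3P[jk|/andP[ja bk]|/andP[ja bk]].
- by rewrite (r_trans _ _ _ ij jk).
- by rewrite (r_trans _ _ _ ij ja) bk orbT.
- by rewrite (r_trans _ _ _ ij ja) bk !orbT.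
- by rewrite ia (r_trans _ _ _ bj jk) orbT.
- by rewrite ia bk orbT.
- by rewrite (r_trans _ _ _ ia bk).
- by rewrite ia (r_trans _ _ _ bj jk) !orbT.
- by rewrite (r_trans _ _ _ ia bk).
- by rewrite ia bk !orbT.
Qed.

(** Since [x] and [y] are incomparable, a cycle through an added relation must
    use both added directions, hence runs through the classes of [x] and of [y]:
    these two classes merge and the others stay as they are. *)
Lemma identify_sim (T : Type) (r : rel T) (x y : T) :
  transitive r -> ~~ r x y -> ~~ r y x -> forall i j,
  identify r x y i j && identify r x y j i =
    [|| r i j && r j i, (r i x && r x i) && (r j y && r y j)
      | (r i y && r y i) && (r j x && r x j)].
Proof.
move=> r_trans nxy nyx i j.
have yx_path := no_path r_trans nyx; have xy_path := no_path r_trans nxy.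
rewrite /identify; apply/idP/idP.
  case/andP => /or3P[ij|/andP[ia bj]|/andP[ia bj]]
    /or3P[ji|/andP[ja bi]|/andP[ja bi]].
  - by rewrite ij ji.
  - by case: (yx_path i j).
  - by case: (xy_path i j).
  - by case: (yx_path j i).
  - by case/negP: nyx; apply: r_trans bj ja.
  - by rewrite ia bj ja bi orbT.
  - by case: (xy_path j i).
  - by rewrite ia bj ja bi !orbT.
  - by case/negP: nxy; apply: r_trans bj ja.
case/or3P=> /andP[]; first by move=> -> ->.
  by move=> /andP[-> ->] /andP[-> ->]; rewrite !orbT.
by move=> /andP[-> ->] /andP[-> ->]; rewrite !orbT.
Qed.

Lemma strict_add_below n (r : rel 'I_n) (a b : 'I_n) (w : pword) :
  reflexive r -> transitive r -> ~~ r a b -> ~~ r b a ->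
  strict (add_below r a b) w = strict r w && (letter w a < letter w b)%N.
Proof.
move=> r_refl r_trans nab nba.
apply/strictP/andP => [rw|[/strictP rw wab] i j].
  have wab : (letter w a < letter w b)%N.
    have [|wab eqab] := rw a b; first by rewrite /add_below !r_refl orbT.
    rewrite ltn_neqAle wab andbT; apply/negP => /eqP/eqab.
    by rewrite /add_below (negbTE nba).
  split=> //; apply/strictP => i j rij.
  have [|wij eqij] := rw i j; first by rewrite /add_below rij.
  split=> // /eqij /orP[//|/andP[ja bi]].
  by case: (no_path r_trans nba bi rij ja).
case/orP => [/rw[wij eqij]|/andP[/rw[wia _] /rw[wbj _]]].
  by split=> // /eqij ji; rewrite /add_below ji.
by split; lia.
Qed.

Lemma strict_identify n (r : rel 'I_n) (x y : 'I_n) (w : pword) :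
  reflexive r -> transitive r -> ~~ r x y -> ~~ r y x ->
  strict (identify r x y) w = strict r w && (letter w x == letter w y).
Proof.
move=> r_refl r_trans nxy nyx.
apply/strictP/andP => [rw|[/strictP rw /eqP wxy] i j].
  have wxy : letter w x = letter w y.
    have [|wxy _] := rw x y; first by rewrite /identify !r_refl orbT.
    have [|wyx _] := rw y x; first by rewrite /identify !r_refl !orbT.
    lia.
  split; last exact/eqP.
  apply/strictP => i j rij.
  have [|wij eqij] := rw i j; first by rewrite /identify rij.
  split=> // /eqij /or3P[//|/andP[jx yi]|/andP[jy xi]].
    by case: (no_path r_trans nyx yi rij jx).
  by case: (no_path r_trans nxy xi rij jy).
rewrite /identify => /or3P[/rw[wij eqij]|/andP[/rw[wi ei] /rw[wj ej]]
  |/andP[/rw[wi ei] /rw[wj ej]]].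
- by split=> // /eqij ->.
- by split=> [|eqij]; [lia|rewrite ej ?ei ?orbT //; lia].
- by split=> [|eqij]; [lia|rewrite ej ?ei ?orbT //; lia].
Qed.

(** The number of classes of [r] is expressed through a labelling [f] whose
    fibres are the classes, since identifying [x] with [y] then just relabels
    the class of [y]. *)
Lemma sum_strict (R : pzRingType) n (r : rel 'I_n) (T : finType)
    (f : 'I_n -> T) :
  reflexive r -> transitive r ->
  (forall i j, (f i == f j) = r i j && r j i) ->
  \sum_(w <- pwords n | strict r w) (-1) ^+ wmax w
    = (-1) ^+ #|f @: [set: 'I_n]| :> R.
Proof.
pose incomparable (r : rel 'I_n) :=
  [set p : 'I_n * 'I_n | ~~ (r p.1 p.2 || r p.2 p.1)].
elim/ltn_ind: {r}#|incomparable r| {-2}r (erefl #|incomparable r|) f.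
move=> m IH r rm f r_refl r_trans fr.
have [/eqP r0|[[x y]]] := set_0Vmem (incomparable r).
  apply: sum_strict_total => // i j; apply/negPn/negP => nij.
  by have /eqP/setP/(_ (i, j)) := r0; rewrite !inE nij.
rewrite inE /= negb_or => /andP[nxy nyx].
have smaller (r' : rel 'I_n) : subrel r r' -> r' x y || r' y x ->
    (#|incomparable r'| < m)%N.
  move=> rr' r'xy; rewrite -rm; apply/proper_card/properP; split.
    apply/subsetP => -[i j]; rewrite !inE /=; apply: contra.
    by case/orP => /rr' ->; rewrite ?orbT.
  by exists (x, y); rewrite !inE /= ?r'xy // negb_or nxy.
have sum_below a b : ~~ r a b -> ~~ r b a ->
    (#|incomparable (add_below r a b)| < m)%N ->
    \sum_(w <- pwords n | strict r w && (letter w a < letter w b)%N)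
      (-1) ^+ wmax w = (-1) ^+ #|f @: [set: 'I_n]| :> R.
  move=> nab nba lt_m; rewrite -(IH _ lt_m (add_below r a b) erefl f).
  - by apply: eq_bigl => w; rewrite strict_add_below.
  - by move=> i; rewrite /add_below r_refl.
  - exact: add_below_trans.
  - by move=> i j; rewrite fr add_below_sim.
have -> : \sum_(w <- pwords n | strict r w) (-1) ^+ wmax w =
    \sum_(w <- pwords n | strict r w && (letter w x < letter w y)%N)
      (-1) ^+ wmax w +
    (\sum_(w <- pwords n | strict r w && (letter w y < letter w x)%N)
      (-1) ^+ wmax w +
     \sum_(w <- pwords n | strict r w && (letter w x == letter w y)%N)
      (-1) ^+ wmax w) :> R.
  rewrite (bigID (fun w => letter w x < letter w y)%N) /=; congr (_ + _).
  rewrite (bigID (fun w => letter w y < letter w x)%N) /=; congr (_ + _);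
    by apply: eq_bigl => w; case: (strict r w) => //=; case: ltngtP.
rewrite !sum_below //; first last.
- by apply: smaller => [i j rij|]; rewrite /add_below ?rij // !r_refl !orbT.
- by apply: smaller => [i j rij|]; rewrite /add_below ?rij // !r_refl !orbT.
pose f' i := if f i == f y then f x else f i.
have fxy : f x != f y by rewrite fr negb_and nxy.
have f'E : f' @: [set: 'I_n] = (f @: [set: 'I_n]) :\ f y.
  apply/setP => c; rewrite !inE; apply/imsetP/andP => [[i _ ->]|[cy]].
    by split; rewrite /f'; case: (eqVneq (f i) (f y)) => [_|fiy];
      rewrite ?fxy ?fiy ?imset_f ?inE.
  by case/imsetP => i _ ci; exists i; rewrite // /f' -ci (negbTE cy).
suff -> : \sum_(w <- pwords n | strict r w && (letter w x == letter w y)%N)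
    (-1) ^+ wmax w = (-1) ^+ #|f' @: [set: 'I_n]| :> R.
  rewrite [#|f @: _|](cardsD1 (f y)) imset_f // -f'E.
  by rewrite exprS mulN1r addNr addr0.
rewrite -(IH _ _ (identify r x y) erefl f').
- by apply: eq_bigl => w; rewrite strict_identify.
- by apply: smaller => [i j rij|]; rewrite /identify ?rij // !r_refl !orbT.
- by move=> i; rewrite /identify r_refl.
- exact: identify_trans.
- move=> i j; rewrite identify_sim // -!fr /f'.
  case: (eqVneq (f i) (f y)) => [->|iy]; case: (eqVneq (f j) (f y)) => [->|jy];
    rewrite ?(negbTE iy) ?(negbTE jy) ?eqxx ?orbT ?andbF ?orbF //=.
  by rewrite andbT.
Qed.

(** * Composition with sorted words *)

Lemma big_seq_bij (V : nmodType) (T T' : eqType) (s : seq T) (s' : seq T')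
    (P : pred T) (P' : pred T') (h : T -> T') (g : T' -> T) (F : T' -> V) :
  uniq s -> uniq s' ->
  (forall x, x \in s -> P x -> [/\ h x \in s', P' (h x) & g (h x) = x]) ->
  (forall y, y \in s' -> P' y -> [/\ g y \in s, P (g y) & h (g y) = y]) ->
  \sum_(x <- s | P x) F (h x) = \sum_(y <- s' | P' y) F y.
Proof.
move=> us us' hP gP; rewrite -big_filter -[RHS]big_filter -[LHS](big_map h predT).
apply/perm_big/uniq_perm => [||y]; last 1 first.
- rewrite mem_filter; apply/mapP/andP => [[x]|[P'y s'y]].
    by rewrite mem_filter => /andP[Px sx] ->; have [] := hP _ sx Px.
  by have [sg Pg hg] := gP _ s'y P'y; exists (g y); rewrite // mem_filter Pg.
- rewrite map_inj_in_uniq ?filter_uniq // => x1 x2.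
  rewrite !mem_filter => /andP[Px1 s1] /andP[Px2 s2] h12.
  by have [_ _ <-] := hP _ s1 Px1; have [_ _ <-] := hP _ s2 Px2; rewrite h12.
- exact: filter_uniq.
Qed.

(** For each [u] coarser than [w] there is exactly one [s] with [u] equal to
    [wcomp s w]: its [a]-th letter is read off [u] at any index where [w] has
    letter [a]. *)
Lemma sum_sorted_wcomp (V : nmodType) n (w : pword) (F : pword -> V) :
  w \in pwords n ->
  \sum_(s <- pwords (wmax w) | sorted leq s) F (wcomp s w) =
    \sum_(u <- pwords n | coarser n w u) F u.
Proof.
move=> wn; have sz_w : size w = n by apply/eqP; rewrite -mem_pwords.
have pos (a : 'I_(wmax w)) : exists2 i : 'I_n, index a.+1 w = i & letter w i = a.+1.
  have [|i wi] := @letter_onto n w a.+1 wn; first by rewrite ltn_ord.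
  have aw : a.+1 \in letters w by rewrite -wi mem_nth ?sz_w.
  have lt_n : (index a.+1 w < n)%N by rewrite -sz_w index_mem.
  by exists (Ordinal lt_n); rewrite // /letter nth_index.
have pred_lt (i : 'I_n) : ((letter w i).-1 < wmax w)%N.
  by rewrite prednK ?letter_leq_wmax // letter_gt0.
have compE s (i : 'I_n) : s \in pwords (wmax w) ->
    letter (wcomp s w) i = letter s (letter w i).-1.
  rewrite mem_pwords => /eqP sw.
  by rewrite {1}/letter wcompE // (nth_map 0%N) // sz_w.
pose g u := word_of (fun a : 'I_(wmax w) => letter u (index a.+1 w)).
have gP u : u \in pwords n -> coarser n w u ->
    g u \in pwords (wmax w) /\
    forall a : 'I_(wmax w), letter (g u) a = letter u (index a.+1 w).
  move=> un /coarserP wu; have [||gn _ gE] := @word_ofP (wmax w)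
    (fun a => letter u (index a.+1 w)) (wmax u).
  - by move=> a; have [i -> _] := pos a; rewrite (letter_gt0 i un) letter_leq_wmax.
  - move=> b /(letter_onto un)[i <-]; exists (Ordinal (pred_lt i)) => /=.
    have [j /= -> /=] := pos (Ordinal (pred_lt i)).
    rewrite prednK ?(letter_gt0 i wn) // => wij.
    by apply/eqP; rewrite eqn_leq !wu // wij.
  - by split.
apply: (big_seq_bij (g := g)); rewrite ?pwords_uniq //.
- move=> s sw s_sorted; have sz_s : size s = wmax w by apply/eqP; rewrite -mem_pwords.
  have comp_n : wcomp s w \in pwords n.
    by rewrite mem_pwords wcompE // size_map sz_w.
  have comp_coarser : coarser n w (wcomp s w).
    apply/coarserP => i j wij; rewrite !compE //.
    apply: (sorted_leq_nth leq_trans leqnn 0%N s_sorted);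
      rewrite ?inE ?sz_s ?pred_lt //.
    by rewrite -!subn1 leq_sub2r.
  have [gn gE] := gP _ comp_n comp_coarser.
  split=> //; apply: (letters_inj gn sw) => a; rewrite gE.
  by have [i -> wi] := pos a; rewrite compE // wi.
- move=> u un wu; have [gn gE] := gP _ un wu; split=> //.
    apply/(sortedP 0%N) => a; have /eqP -> : size (g u) == wmax w by rewrite -mem_pwords.
    move=> lt_a; rewrite -/(letter (g u) a) -/(letter (g u) a.+1).
    rewrite (gE (Ordinal lt_a)) (gE (Ordinal (ltnW lt_a))).
    have [i -> wi] := pos (Ordinal lt_a); have [j -> wj] := pos (Ordinal (ltnW lt_a)).
    by apply: (coarser_le wu); rewrite wi wj /=.
  have comp_n : wcomp (g u) w \in pwords n.
    by move: (gn); rewrite !mem_pwords => /eqP sz_g; rewrite wcompE // size_map sz_w.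
  apply: (letters_inj comp_n un) => i; rewrite compE // (gE (Ordinal (pred_lt i))).
  have [j -> wj] := pos (Ordinal (pred_lt i)); move: wj => /=.
  rewrite prednK ?(letter_gt0 i wn) // => wij.
  by apply/eqP; rewrite eqn_leq !(coarser_le wu) ?wij.
Qed.

(** A sign-reversing bijection between the words that separate two chosen
    blocks of [w] and the words that merge them. *)
Lemma sum_between (R : pzRingType) n (w u : pword) :
  w \in pwords n -> u \in pwords n -> coarser n w u -> w != u ->
  \sum_(v <- pwords n | coarser n w v && coarser n v u) (-1) ^+ wmax v = 0 :> R.
Proof.
move=> wn un wu neq_wu.
have [x [y [wxy uxy]]] : exists x y : 'I_n,
    letter w y = (letter w x).+1 /\ letter u x = letter u y.
  have /forallPn[j /forallPn[i]] : ~~ coarser n u w.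
    by apply: contra neq_wu => uw; apply/eqP; apply: coarser_anti uw.
  rewrite negb_imply -ltnNge => /andP[uji wij].
  have [|y wy] := @letter_onto n w (letter w i).+1 wn.
    by have := letter_leq_wmax j wn; lia.
  exists i, y; split=> //; apply/eqP; rewrite eqn_leq (coarser_le wu) ?wy //=.
  by apply: leq_trans uji; apply: (coarser_le wu); rewrite wy.
(* The block of [y] follows that of [x] in [w], and [u] does not tell the two
   apart.  In a word between [w] and [u], shifting by one the letters at all
   indices from the block of [y] upwards separates or merges the two blocks. *)
pose upper (i : 'I_n) := (letter w y <= letter w i)%N.
pose split_at v := word_of (fun i => letter v i + upper i)%N.
pose merge_at v := word_of (fun i => letter v i - upper i)%N.
have upx : upper x = false by rewrite /upper wxy ltnn.
have upy : upper y by rewrite /upper.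
have lower i : upper i = false -> (letter w i <= letter w x)%N.
  by rewrite /upper wxy => /negbT; rewrite -ltnNge.
have splitP v : v \in pwords n -> coarser n w v -> letter v x = letter v y ->
    [/\ split_at v \in pwords n, wmax (split_at v) = (wmax v).+1 &
        forall i : 'I_n, letter (split_at v) i = (letter v i + upper i)%N].
  move=> vn /coarserP wv vxy; apply: word_ofP => [i|a a_bound].
    by have := letter_gt0 i vn; have := letter_leq_wmax i vn; case: (upper i); lia.
  case: (ltngtP a (letter v x)) => [a_lt|a_gt|->]; last by exists x; rewrite upx addn0.
    have [|i vi] := @letter_onto n v a vn; first by have := letter_leq_wmax x vn; lia.
    exists i; case: (boolP (upper i)) => [/wv|]; lia.
  case: (ltngtP a (letter v x).+1) => [|a_gt'|->]; first by lia.
    have [|i vi] := @letter_onto n v a.-1 vn; first by lia.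
    exists i; case: (boolP (upper i)) => [|/negbTE/lower/wv]; lia.
  by exists y; rewrite upy vxy addn1.
have gap v : v \in pwords n -> coarser n w v -> letter v x != letter v y ->
    letter v y = (letter v x).+1.
  move=> vn /coarserP wv vxy; apply/eqP; rewrite eqn_leq ltn_neqAle vxy wv ?wxy //=.
  rewrite andbT leqNgt; apply/negP => lt_xy.
  have [|i vi] := @letter_onto n v (letter v x).+1 vn.
    by have := letter_leq_wmax y vn; lia.
  by case: (boolP (upper i)) => [/wv|/negbTE/lower/wv]; lia.
have mergeP v : v \in pwords n -> coarser n w v -> letter v x != letter v y ->
    [/\ merge_at v \in pwords n, wmax (merge_at v) = (wmax v).-1 &
        forall i : 'I_n, letter (merge_at v) i = (letter v i - upper i)%N].
  move=> vn wv vxy; have vy := gap v vn wv vxy; move/coarserP: wv => wv.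
  have vx0 := letter_gt0 x vn; have vy_max := letter_leq_wmax y vn.
  apply: word_ofP => [i|a a_bound].
    have := letter_gt0 i vn; have := letter_leq_wmax i vn.
    by case: (boolP (upper i)) => [/wv|/negbTE/lower/wv]; lia.
  case: (leqP a (letter v x)) => a_x.
    have [|i vi] := @letter_onto n v a vn; first by lia.
    exists i; case: (boolP (upper i)) => [/wv|]; lia.
  have [|i vi] := @letter_onto n v a.+1 vn; first by lia.
  exists i; case: (boolP (upper i)) => [|/negbTE/lower/wv]; lia.
rewrite (bigID (fun v => letter v x == letter v y)) /= addrC.
apply/eqP; rewrite addr_eq0 eq_sym -sumrN; apply/eqP.
transitivity (\sum_(v <- pwords n |
    (coarser n w v && coarser n v u) && (letter v x == letter v y))
      (-1) ^+ wmax (split_at v) : R).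
  rewrite big_seq_cond [RHS]big_seq_cond; apply: eq_bigr => v.
  case/andP=> vn /andP[/andP[wv _] /eqP vxy].
  by have [_ -> _] := splitP v vn wv vxy; rewrite exprS mulN1r.
apply: (big_seq_bij (h := split_at) (g := merge_at)); rewrite ?pwords_uniq //.
- move=> v vn /andP[/andP[wv vu] /eqP vxy].
  have [sn _ sE] := splitP v vn wv vxy.
  have ws : coarser n w (split_at v).
    apply/coarserP => i j wij; rewrite !sE /upper.
    by have := coarser_le wv wij; lia.
  have su : coarser n (split_at v) u.
    apply/coarserP => i j; rewrite !sE => sij; apply: (coarser_le vu); move: sij.
    case: (boolP (upper i)) => [_|/negbTE/lower/(coarser_le wv)]; first by lia.
    by case: (boolP (upper j)) => [/(coarser_le wv)|_]; lia.
  have sxy : letter (split_at v) x != letter (split_at v) y.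
    by rewrite !sE upx upy vxy; lia.
  have [mn _ mE] := mergeP _ sn ws sxy; split=> //; first by rewrite ws su.
  by apply: (letters_inj mn vn) => i; rewrite mE sE addnK.
- move=> v vn /andP[/andP[wv vu] vxy].
  have [mn _ mE] := mergeP v vn wv vxy; have vy := gap v vn wv vxy.
  have wm : coarser n w (merge_at v).
    apply/coarserP => i j wij; rewrite !mE; have := coarser_le wv wij.
    case: (boolP (upper i)) => [yi|/negbTE/lower/(coarser_le wv)].
      by have -> : upper j := leq_trans yi wij; lia.
    by case: (boolP (upper j)) => [/(coarser_le wv)|_]; lia.
  have mu : coarser n (merge_at v) u.
    apply/coarserP => i j; rewrite !mE => mij.
    case: (leqP (letter v i) (letter v j)) => [/(coarser_le vu)//|lt_ji].
    move: mij; case: (boolP (upper i)) => [/(coarser_le wv) yi|_]; last first.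
      by rewrite subn0 => /leq_trans/(_ (leq_subr _ _)); lia.
    case: (boolP (upper j)) => [_|/negbTE/lower/(coarser_le wv) jx].
      by have := letter_gt0 j vn; lia.
    move=> mij; apply: (@leq_trans (letter u x)).
      by rewrite uxy; apply: (coarser_le vu); lia.
    by apply: (coarser_le vu); lia.
  have mxy : letter (merge_at v) x = letter (merge_at v) y.
    by rewrite !mE upx upy vy; lia.
  have [sn _ sE] := splitP _ mn wm mxy; split=> //; first by rewrite wm mu mxy eqxx.
  apply: (letters_inj sn vn) => i; rewrite sE mE subnK //.
  by case: (upper i) => //; apply: letter_gt0 vn.
Qed.

(** * The map [Phi_m1] *)

HB.instance Definition _ (K : fieldType) :=
  GRing.isLinear.Build K (WQSym K) (WQSym K) _ (@Phi_m1 K)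
    (@fglift_linear K pword (WQSym K) _).

Lemma Phi_m1_word (K : fieldType) n (w : pword) : w \in pwords n ->
  Phi_m1 (<< w >> : WQSym K) = (-1) ^+ wmax w *:
    \sum_(u <- pwords n | coarser n w u) (<< u >> : WQSym K).
Proof.
move=> wn; rewrite /Phi_m1 fglift_basis; congr (_ *: _).
exact: (sum_sorted_wcomp (fun u => << u >> : WQSym K) wn).
Qed.

Lemma Phi_m1_sum (K : fieldType) n (A : pred pword) :
  Phi_m1 (\sum_(w <- pwords n | A w) (<< w >> : WQSym K)) =
  \sum_(u <- pwords n)
    (\sum_(w <- pwords n | A w && coarser n w u) (-1) ^+ wmax w) *:
      (<< u >> : WQSym K).
Proof.
rewrite linear_sum /= big_seq_cond.
under eq_bigr => w /andP[wn _] do rewrite (Phi_m1_word K wn) scaler_sumr.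
rewrite -big_seq_cond [LHS](exchange_big_dep predT) //=; apply: eq_bigr => u _.
by rewrite scaler_suml.
Qed.

Lemma Phi_m1_involutive (K : fieldType) n (w : pword) : w \in pwords n ->
  Phi_m1 (Phi_m1 (<< w >> : WQSym K)) = << w >>.
Proof.
move=> wn; rewrite (Phi_m1_word K wn) linearZ /= (Phi_m1_sum K n (coarser n w)).
rewrite (bigD1_seq w) ?pwords_uniq //= [X in _ + X]big1_seq ?addr0.
  rewrite (eq_bigl (fun v => coarser n w v && coarser n v w)) //.
  rewrite big_seq_cond (eq_bigl (pred1 w)); last first.
    move=> v /=; apply/and3P/eqP => [[vn wv vw]|->]; last by rewrite coarser_refl.
    exact: coarser_anti vn wn vw wv.
  rewrite -big_filter filter_pred1_uniq ?pwords_uniq // big_seq1.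
  by rewrite scalerA -exprD addnn -mul2n exprM sqrrN !expr1n scale1r.
move=> u /andP[neq_uw un]; case: (boolP (coarser n w u)) => wu.
  by rewrite sum_between ?scale0r // eq_sym.
rewrite big_pred0 ?scale0r // => v; apply/negbTE/negP => /andP[wv vu].
by case/negP: wu; apply/coarserP => i j /(coarser_le wv) /(coarser_le vu).
Qed.

(** * The duality principle *)

Lemma WstrE (P : QP) (w : pword) : w \in pwords (tag P) ->
  (w \in Wstr P) = strict (@qle P) w.
Proof.
rewrite mem_pwords => wn; rewrite unfold_in /= [w \in W P]unfold_in wn.
apply/andP/strictP => [[/forallP wW /forallP wS] i j ij|sw].
  split; first exact: (implyP (forallP (wW i) j)).
  move=> wij; have /forallP/(_ j)/implyP := wS i.
  by rewrite ij wij eqxx /qsim => /(_ isT)/andP[].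
split; apply/forallP => i; apply/forallP => j; apply/implyP.
  by case/sw.
by case/andP => ij /eqP wij; rewrite /qsim ij (sw _ _ ij).2.
Qed.

Lemma WP (P : QP) (w : pword) : w \in pwords (tag P) ->
  reflect (forall i j : 'I_(tag P), qle i j -> (letter w i <= letter w j)%N) (w \in W P).
Proof.
rewrite mem_pwords => wn; rewrite unfold_in wn.
apply: (iffP forallP) => [wW i j|wW i]; first exact: (implyP (forallP (wW i) j)).
by apply/forallP => j; apply/implyP/wW.
Qed.

(** Being finer than [u] and strict for [P] amounts to being strict for the
    preorder that compares indices by their letters in [u], then by [P].  When
    [u] is in [W P], indices equivalent for [P] have equal letters in [u], so
    this preorder has the classes of [P]. *)
Lemma sum_Wstr_refining (R : pzRingType) (P : QP) (u : pword) :
  u \in pwords (tag P) ->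
  \sum_(w <- pwords (tag P) | (w \in Wstr P) && coarser (tag P) w u)
    (-1) ^+ wmax w = if u \in W P then (-1) ^+ cl P else 0 :> R.
Proof.
move=> un; case: (boolP (u \in W P)) => [/(WP un) uW|uW]; last first.
  rewrite big_seq_cond big_pred0 // => w; apply/negbTE/negP => /and3P[wn wS wu].
  case/negP: uW; apply/(WP un) => i j ij; apply: (coarser_le wu).
  by move: wS; rewrite WstrE // => /strictP/(_ _ _ ij)[].
pose lex (i j : 'I_(tag P)) :=
  (letter u i < letter u j)%N || (letter u i == letter u j) && qle i j.
have simE i j : lex i j && lex j i = qsim i j.
  rewrite /lex /qsim; case: ltngtP => //= uij.
    by apply/esym/negbTE/negP => /andP[_ /uW]; rewrite leqNgt uij.
  by apply/esym/negbTE/negP => /andP[/uW + _]; rewrite leqNgt uij.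
have sim_trans : transitive (@qsim P).
  move=> j i k /andP[ij ji] /andP[jk kj].
  by rewrite /qsim (qle_trans ij jk) (qle_trans kj ji).
transitivity (\sum_(w <- pwords (tag P) | strict lex w) (-1) ^+ wmax w : R).
  rewrite big_seq_cond [RHS]big_seq_cond; apply: eq_bigl => w.
  case: (boolP (w \in pwords (tag P))) => //= wn; rewrite WstrE //.
  apply/andP/strictP => [[/strictP wS wu] i j|wL].
    case/orP => [uij|/andP[/eqP uij ij]].
      have wij : (letter w i < letter w j)%N.
        by rewrite ltnNge; apply: contraL uij => /(coarser_le wu); rewrite -leqNgt.
      by split=> [|eq_ij]; [exact: ltnW | rewrite eq_ij ltnn in wij].
    by have [wij eq_ij] := wS _ _ ij; split=> // /eq_ij ji; rewrite /lex uij eqxx ji orbT.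
  have wu : coarser (tag P) w u.
    apply/coarserP => i j wij; rewrite leqNgt; apply/negP => uji.
    have [|wji eq_ji] := wL j i; first by rewrite /lex uji.
    have := eq_ji (anti_leq (introT andP (conj wji wij))).
    by rewrite /lex ltnNge (ltnW uji) gtn_eqF.
  split=> //; apply/strictP => i j ij.
  have lij : lex i j by rewrite /lex ij andbT orbC -leq_eqVlt uW.
  have [wij eq_ij] := wL _ _ lij; split=> // /eq_ij lji.
  by have := simE i j; rewrite lij lji => /esym/andP[].
have -> : cl P = #|(fun i => [set j | qsim i j]) @: [set: 'I_(tag P)]|.
  by congr #|pred_of_set _|; apply: eq_imset => i; apply/setP => j; rewrite !inE.
apply: sum_strict => [i|j i k|i j].
- by rewrite /lex eqxx qle_refl orbT.
- rewrite /lex => /orP[ij|/andP[/eqP-> ij]] /orP[jk|/andP[/eqP<- jk]].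
  + by rewrite (ltn_trans ij jk).
  + by rewrite ij.
  + by rewrite jk.
  + by rewrite eqxx (qle_trans ij jk) orbT.
- rewrite simE; apply/eqP/idP => [/setP/(_ j)|ij].
    by rewrite !inE {2}/qsim !qle_refl.
  apply/setP => k; rewrite !inE; apply/idP/idP; apply: sim_trans => //.
  by rewrite /qsim andbC.
Qed.

Theorem theorem45 (K : fieldType) (charK : [pchar K] =i pred0) (P : QP) :
  EHR (<< P >> : HQP K) = (-1) ^+ cl P *: Phi_m1 (EHRstr (<< P >> : HQP K)) /\
  EHRstr (<< P >> : HQP K) = (-1) ^+ cl P *: Phi_m1 (EHR (<< P >> : HQP K)).
Proof.
have signK (x : WQSym K) : (-1) ^+ cl P *: ((-1) ^+ cl P *: x) = x.
  by rewrite scalerA -exprD addnn -mul2n exprM sqrrN !expr1n scale1r.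
have eqEHR : EHR (<< P >> : HQP K)
    = (-1) ^+ cl P *: Phi_m1 (EHRstr (<< P >> : HQP K)).
  rewrite /EHR /EHRstr !fglift_basis (Phi_m1_sum K _ (fun w => w \in Wstr P)).
  rewrite scaler_sumr big_mkcond [LHS]big_seq [RHS]big_seq; apply: eq_bigr => u un.
  rewrite sum_Wstr_refining //; case: ifP => _; last by rewrite scale0r scaler0.
  by rewrite signK.
split=> //; rewrite eqEHR linearZ /= signK /EHRstr fglift_basis !linear_sum /=.
rewrite big_seq_cond [RHS]big_seq_cond; apply: eq_bigr => w /andP[wn _].
by rewrite (Phi_m1_involutive K wn).
Qed.
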